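(* Let $k \geq 2$ be an integer and suppose that $q=p^n$ is a prime power ($p$ prime, $n \ge 1$) such that $q \equiv 1 \bmod 2k$. Then $\mathbb{F}_p^{\times} \leq (\mathbb{F}_q^{\times})^k$ if and only if $k \mid \frac{q-1}{p-1}$.
   Context: For a finite field $\mathbb{F}_q$, $(\mathbb{F}_q^{\times})^k=\{\alpha\in\mathbb{F}_q^\times \mid \alpha=\beta^k \text{ for some } \beta\in\mathbb{F}_q^\times\}$ is the subgroup of nonzero $k$-th powers in the multiplicative group $\mathbb{F}_q^\times$. If $q$ is a power of the prime $p$, then $\mathbb{F}_p$ is regarded as the prime subfield of $\mathbb{F}_q$, and $\le$ denotes the subgroup relation inside $\mathbb{F}_q^\times$. *)

(* Defs.v *)
From mathcomp Require Import all_boot all_order all_algebra all_fingroup.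
From mathcomp Require Import all_solvable all_field.

Set Implicit Arguments.
Unset Strict Implicit.
Unset Printing Implicit Defensive.

Import GRing.Theory.
Local Open Scope ring_scope.

Section PrimeSubfield.
Variable F : finFieldType.

(* Boolean form of [GRing.divring_closed]; since 0^-1 = 0, the case y = 0 of
   x / y \in A only asks that 0 \in A. *)
Definition is_subfield (A : {set F}) : bool :=
  [&& 1 \in A, [forall x in A, forall y in A, x - y \in A]
    & [forall x in A, forall y in A, x / y \in A]].

Lemma is_subfieldP (A : {set F}) :
  reflect (GRing.divring_closed A) (is_subfield A).
Proof.
apply: (iffP and3P) => [[A1 AB AV]|[A1 AB AV]]; split=> //.
- by move=> x y Ax Ay; move/forall_inP/(_ x Ax)/forall_inP/(_ y Ay): AB.
- by move=> x y Ax Ay; move/forall_inP/(_ x Ax)/forall_inP/(_ y Ay): AV.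
- by apply/forall_inP=> x Ax; apply/forall_inP=> y Ay; apply: AB.
- by apply/forall_inP=> x Ax; apply/forall_inP=> y Ay; apply: AV.
Qed.

Definition prime_subfield : {set F} :=
  \bigcap_(A : {set F} | is_subfield A) A.

Lemma prime_subfield_is_subfield : is_subfield prime_subfield.
Proof.
apply/is_subfieldP; split.
- by apply/bigcapP=> A /is_subfieldP[].
- move=> x y /bigcapP Px /bigcapP Py; apply/bigcapP=> A sA.
  by case/is_subfieldP: (sA) => _ AB _; apply: AB; [apply: Px | apply: Py].
- move=> x y /bigcapP Px /bigcapP Py; apply/bigcapP=> A sA.
  by case/is_subfieldP: (sA) => _ _ AV; apply: AV; [apply: Px | apply: Py].
Qed.

(* The prime subfield is the canonical copy of 'F_p in F. *)
Lemma prime_subfieldE (p : nat) : p \in [pchar F] ->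
  prime_subfield = [set (val a)%:R | a : 'F_p].
Proof.
move=> charFp; have p_pr := pcharf_prime charFp.
pose f (a : 'F_p) : F := (val a)%:R.
have fn m : f m%:R = m%:R.
  rewrite /f /= val_Fp_nat // {2}(divn_eq m p) natrD natrM.
  by rewrite (pcharf0 charFp) mulr0 add0r.
have fD a b : f (a + b) = f a + f b.
  by rewrite -[a]natr_Zp -[b]natr_Zp -natrD !fn natrD.
have fM a b : f (a * b) = f a * f b.
  by rewrite -[a]natr_Zp -[b]natr_Zp -natrM !fn natrM.
have f1 : f 1 = 1 by exact: (fn 1%N).
apply/setP=> x; apply/idP/imsetP=> [/bigcapP Px | [a _ ->]].
  apply/imsetP; apply: Px; apply/is_subfieldP; split.
  - by apply/imsetP; exists 1.
  - move=> _ _ /imsetP[a _ ->] /imsetP[b _ ->]; apply/imsetP.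
    by exists (a - b) => //; rewrite -[LHS]/(f a - f b) -{1}(subrK b a) fD addrK.
  - move=> _ _ /imsetP[a _ ->] /imsetP[b _ ->]; apply/imsetP.
    exists (a / b) => //; rewrite -[LHS]/(f a / f b) -[RHS]/(f (a / b)).
    have [-> | b_nz] := eqVneq b 0.
      have f0 : f 0 = 0 := fn 0%N.
      by rewrite fM f0 invr0.
    have fb_nz : f b != 0.
      apply: contra_neq (oner_neq0 F) => fb0.
      by rewrite -f1 -(mulfV b_nz) fM fb0 mul0r.
    by apply: (mulIf fb_nz); rewrite divfK // -fM divfK.
have /is_subfieldP[P1 PB _] := prime_subfield_is_subfield.
have P0 : 0 \in prime_subfield by rewrite -(subrr 1) PB.
elim: (val a) => [//|m IHm].
by rewrite -addn1 natrD -[1%:R]opprK PB // -[- _]add0r PB.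
Qed.

End PrimeSubfield.

Section UnitSubgroups.
Variable F : finFieldType.

Definition prime_units : {set {unit F}} :=
  [set a : {unit F} | FinRing.uval a \in prime_subfield F].

Lemma prime_units_group_set : group_set prime_units.
Proof.
have /is_subfieldP sF := prime_subfield_is_subfield F; case: (sF) => P1 PB PV.
apply/group_setP; split=> [|a b]; rewrite !inE //= => Pa Pb.
by rewrite -[FinRing.uval b]invrK PV // -[_^-1]mul1r PV.
Qed.
Canonical prime_units_group := Group prime_units_group_set.

Definition power_units (k : nat) : {set {unit F}} :=
  [set a : {unit F} | [exists b : {unit F}, a == (b ^+ k)%g]].

Lemma power_units_group_set k : group_set (power_units k).
Proof.
apply/group_setP; split=> [|x y].
  by rewrite inE; apply/existsP; exists 1%g; rewrite expg1n.
rewrite !inE => /existsP[a /eqP->] /existsP[b /eqP->].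
apply/existsP; exists (a * b)%g; rewrite expgMn //; apply: val_inj.
by rewrite /= mulrC.
Qed.
Canonical power_units_group k := Group (power_units_group_set k).

End UnitSubgroups.

(* Main.v *)
(* The unit group of F is cyclic of order q - 1, so inclusion of subgroups is
   divisibility of orders: the prime units have order p - 1 and, as k divides
   q - 1, the k-th powers have order (q - 1) / k. *)
Require Import Defs.
From mathcomp Require Import all_boot all_order all_algebra all_fingroup.
From mathcomp Require Import all_solvable all_field.

Import GRing.Theory.

(** By [prime_subfieldE] this set is the image of ['F_p]. Distinct representatives below [p] differ
    by a nonmultiple of [p], so their images in characteristic [p] are distinct. *)
Lemma card_prime_subfield {F : finFieldType} {p : nat} :
  p \in [pchar F]%R -> #|prime_subfield F| = p.
Proof.
move=> charFp; have p_pr := pcharf_prime charFp.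
rewrite (prime_subfieldE charFp) card_imset ?card_Fp // => a b.
(* Subtraction on [nat] is truncated, so [natrB] needs the larger representative first. *)
wlog le_ba : a b / val b <= val a => [IH eq_ab|].
  by case/orP: (leq_total (val b) (val a)) => /IH ->.
move=> /eqP; rewrite -subr_eq0 -natrB // -(dvdn_pcharf charFp) => dvd_p.
have lt_ap : val a < p by rewrite -[X in _ < X](Fp_cast p_pr) ltn_ord.
apply/val_inj/eqP; rewrite eqn_leq le_ba andbT -subn_eq0.
(* The difference is below [p], hence equal to its remainder mod [p], which is 0 by [dvd_p]. *)
by rewrite -(modn_small (leq_ltn_trans (leq_subr (val b) _) lt_ap)).
Qed.

(** The coercion of units into [F] maps these units bijectively onto the nonzero elements of the
    prime subfield. *)
Lemma card_prime_units {F : finFieldType} {p : nat} :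
  p \in [pchar F]%R -> #|prime_units F| = p.-1.
Proof.
move=> charFp.
have -> : #|prime_units F| = #|prime_subfield F :\ 0%R|.
  rewrite -(card_imset (mem (prime_units F)) val_inj); apply: eq_card => x.
  rewrite in_setD1; apply/imsetP/andP => [[u u_prime ->]|[x_nz x_prime]].
    by rewrite -unitfE (valP u); move: u_prime; rewrite inE.
  have x_unit : (x \is a GRing.unit)%R by rewrite unitfE.
  by exists (FinRing.unit F x_unit); rewrite ?inE.
have /is_subfieldP[P1 PB _] := prime_subfield_is_subfield F.
have P0 : 0%R \in prime_subfield F by rewrite -(subrr 1%R) PB.
by rewrite -(card_prime_subfield charFp) (cardsD1 0%R (prime_subfield F)) P0.
Qed.

(** For a generator [g], [(g ^+ i) ^+ k = (g ^+ k) ^+ i], so the powers form the cyclic group of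
    [g ^+ k]; its order is that of [g] divided by [k], as [k] divides the latter. *)
Lemma card_power_units {F : finFieldType} {k : nat} :
  k %| #|F|.-1 -> #|power_units F k| = #|F|.-1 %/ k.
Proof.
move=> k_dvd.
have /cyclicP[g gen_g] := field_unit_group_cyclic [set: {unit F}]%G.
have order_g : #[g]%g = #|F|.-1 by rewrite orderE -gen_g card_finField_unit.
suff -> : power_units F k = <[g ^+ k]>%g.
  by rewrite -orderE orderXdiv order_g.
apply/setP => x; rewrite inE.
apply/existsP/cycleP => [[y /eqP ->]|[i ->]].
  have /cycleP[i ->] : y \in <[g]>%g by rewrite -gen_g inE.
  by exists i; rewrite -!expgM mulnC.
by exists (g ^+ i)%g; rewrite -!expgM mulnC.
Qed.

Theorem theorem1p7 (k p n q : nat) (F : finFieldType)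
    (k_ge2 : 2 <= k) (p_prime : prime p) (n_ge1 : 1 <= n)
    (q_def : q = p ^ n) (cardF : #|F| = q)
    (q_mod : q = 1 %[mod 2 * k]) :
  prime_units_group F \subset power_units_group F k
    <-> k %| (q - 1) %/ (p - 1).
Proof.
have q_gt0 : 0 < q by rewrite q_def expn_gt0 prime_gt0.
have charFp : p \in [pchar F]%R.
  by apply: (card_finPcharP (n := n)); rewrite ?cardF.
have k_dvd : k %| q.-1.
  rewrite -subn1; apply: (dvdn_trans (dvdn_mull 2 (dvdnn k))).
  by rewrite -eqn_mod_dvd //; apply/eqP.
(* Lagrange's theorem for the prime units inside the full unit group. *)
have p1_dvd : p.-1 %| q.-1.
  rewrite -(card_prime_units charFp) -cardF -card_finField_unit.
  exact: cardSg (subsetT (prime_units_group F)).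
have cyc := field_unit_group_cyclic [set: {unit F}]%G.
rewrite -(cardSg_cyclic cyc) ?subsetT //= (card_prime_units charFp).
rewrite card_power_units cardF // !subn1.
(* Both divisibilities now say that [k * p.-1] divides [q.-1]. *)
by rewrite !dvdn_divRL // mulnC.
Qed.
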